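(* In dimension $3$ the following hold. (a) $\gamma(C_3^*,r)=10$ for every $r\in\left(\frac35,\frac23\right]$. (b) $\gamma(C_3^*,r)=12$ for every $r\in\left(\frac47,\frac35\right]$. (c) $\gamma(C_3^*,r)\leq 14$ for every $r\in\left(\frac12,\frac47\right]$.
   Context: $C_3^*=\{\mathbf{x}\in\mathbb{R}^3 : |x_1|+|x_2|+|x_3|\leq 1\}$ is the unit cross-polytope and $\|\cdot\|_1$ is the $l_1$-norm on $\mathbb{R}^3$. For $r>0$, $\gamma(C_3^*,r):=\max\{|D| : D\subset C_3^*\text{ and }\|\mathbf{x}-\mathbf{y}\|_1\geq 2r\text{ for all }\mathbf{x},\mathbf{y}\in D,\ \mathbf{x}\neq\mathbf{y}\}$, where $|D|$ denotes the cardinality of $D$. *)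

(* Defs.v *)
From mathcomp Require Import all_boot all_order all_algebra.
From mathcomp Require Import all_classical all_reals.
Set Implicit Arguments.
Unset Strict Implicit.
Unset Printing Implicit Defensive.
Import Order.TTheory GRing.Theory Num.Theory.
Local Open Scope ring_scope.
Local Open Scope classical_set_scope.
Local Open Scope card_scope.

(* The library norm on 'rV[R]_n is the sup norm, hence a separate l_1-norm. *)
Definition l1norm (R : realType) (n : nat) (x : 'rV[R]_n) : R :=
  \sum_(i < n) `|x ord0 i|.

Definition cross_polytope (R : realType) (n : nat) : set 'rV[R]_n :=
  [set x | l1norm x <= 1].

Definition separated (R : realType) (n : nat) (r : R) (D : set 'rV[R]_n) : Prop :=
  forall x y, D x -> D y -> x <> y -> 2 * r <= l1norm (x - y).

(* [is_gamma X r m] says gamma(X, r) = m: the maximum defining gamma(X, r) is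
   attained and equals m.  The sets D are arbitrary, a priori possibly
   infinite; `I_m is {0, ..., m - 1}, and #=, #<= compare cardinalities. *)
Definition is_gamma (R : realType) (n : nat) (X : set 'rV[R]_n) (r : R)
    (m : nat) : Prop :=
  (exists D : set 'rV[R]_n, [/\ D `<=` X, separated r D & D #= `I_m]) /\
  (forall D : set 'rV[R]_n, D `<=` X -> separated r D -> D #<= `I_m).

(* Main.v *)
(* Upper bounds: for d < 2r, the polytope is cut into sets of l_1-diameter at
   most d, each of which contains at most one point of a separated set.  Six of
   them are the caps at the vertices, |x|_1 <= 2 s x_i + (d - 1) with s = +-1.
   What remains in an octant lies in the tetrahedron with vertices (d-1)(1,1,1)
   and, up to permutation, (1 - d/2, 1 - d/2, d - 1).  For d = 1 these 8
   tetrahedra have diameter 1.  For d = 6/5 each of the 4 unions of a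
   tetrahedron with its mirror image in x_3 = 0 has diameter 6/5.  For d = 8/7
   these unions are slightly too large: the corners cut off from the upper
   tetrahedra are regrouped into two further sets.
   Lower bounds: the vertices together with 4, resp. 6, points in the facets. *)
Require Import Defs.
From mathcomp Require Import all_boot all_order all_algebra.
From mathcomp Require Import all_classical all_reals.
From mathcomp Require Import lra.
Set Implicit Arguments.
Unset Strict Implicit.
Unset Printing Implicit Defensive.
Import Order.TTheory GRing.Theory Num.Theory.
Local Open Scope ring_scope.
Local Open Scope classical_set_scope.
Local Open Scope card_scope.

Lemma card_le_fin (T : Type) (I : finType) (D : set T) (f : T -> I) :
  {in D &, injective f} -> D #<= `I_#|I|.
Proof.
move=> injf; have injg : {in D &, injective (fun x => enum_rank (f x) : nat)}.
  by move=> x y Dx Dy /val_inj/enum_rank_inj; exact: injf.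
rewrite -(card_le_eql (inj_card_eq injg)); apply: subset_card_le.
by move=> _ [x _ <-] /=; exact: ltn_ord.
Qed.

Section Packing.
Variables (R : realType) (n : nat).
Implicit Types (x y : 'rV[R]_n) (r d : R) (D : set 'rV[R]_n).

Lemma normB_same_sign (a b : R) :
  (a < 0) = (b < 0) -> `|a - b| = `| `|a| - `|b| |.
Proof.
case: (ltrP a 0) => a0; case: (ltrP b 0) => b0 // _.
  by rewrite (ltr0_norm a0) (ltr0_norm b0) -opprD normrN.
by rewrite (ger0_norm a0) (ger0_norm b0).
Qed.

(** The absolute value merges the caps at the two opposite vertices on axis [i]; the sign of the
    coordinate tells them apart. *)
Definition in_cap d x (i : 'I_n) : bool := l1norm x <= 2 * `|x ord0 i| + (d - 1).

(** Off [i], the triangle inequality bounds the distance. If $|y_i| \leq |x_i|$, adding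
    [l1norm x <= 1] to the cap inequality of [y] gives [d]. *)
Lemma cap_diam d x y (i : 'I_n) :
  l1norm x <= 1 -> l1norm y <= 1 -> in_cap d x i -> in_cap d y i ->
  (x ord0 i < 0) = (y ord0 i < 0) -> l1norm (x - y) <= d.
Proof.
move=> x1 y1; rewrite /in_cap => xi yi sxy.
have rest : \sum_(j < n | j != i) `|(x - y) ord0 j| <=
    \sum_(j < n | j != i) `|x ord0 j| + \sum_(j < n | j != i) `|y ord0 j|.
  by rewrite -big_split; apply: ler_sum => j _; rewrite !mxE; exact: ler_normB.
have normE (z : 'rV[R]_n) :
    l1norm z = `|z ord0 i| + \sum_(j < n | j != i) `|z ord0 j|.
  by rewrite /l1norm (bigD1 i).
move: x1 y1 xi yi rest; rewrite !normE [(x - y) _ i]mxE [(- y) _ i]mxE.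
rewrite (normB_same_sign sxy).
move: `|x ord0 i| `|y ord0 i| => a b {sxy}.
move: (\sum_(j | _) _) (\sum_(j | _) _) (\sum_(j | _) _) => s t u.
by case: (lerP b a); lra.
Qed.

(** Pigeonhole on two caps per axis and the classes of [col] outside the caps. *)
Lemma separated_card_le (I : finType) (col : 'rV[R]_n -> I) d r D :
  d < 2 * r -> D `<=` cross_polytope (n := n) -> separated r D ->
  (forall x y, (forall i, ~~ in_cap d x i) -> (forall i, ~~ in_cap d y i) ->
     l1norm x <= 1 -> l1norm y <= 1 -> col x = col y -> l1norm (x - y) <= d) ->
  D #<= `I_(n * 2 + #|I|).
Proof.
move=> dr DC sepD colP.
pose f x : 'I_n * bool + I :=
  if [pick i | in_cap d x i] is Some i then inl (i, x ord0 i < 0) else inr (col x).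
have <- : #|{: 'I_n * bool + I}| = (n * 2 + #|I|)%N.
  by rewrite card_sum card_prod card_ord card_bool.
apply: (@card_le_fin _ _ _ f) => x y /[!inE] Dx Dy fxy.
apply: contrapT => xy; have := sepD _ _ Dx Dy xy; rewrite leNgt => /negP; apply.
apply: le_lt_trans dr; move: fxy; rewrite /f.
case: pickP => [i xi|xN]; case: pickP => [j yj|yN] //.
  by case=> ij s; move: yj s; rewrite -ij => yi s; apply: cap_diam s => //; exact: DC.
by case=> cxy; apply: colP cxy; try exact: DC; move=> i; rewrite ?xN ?yN.
Qed.

(** The attained sizes are bounded and include 0, by the empty set, so a largest one exists. *)
Lemma is_gamma_ex_le r (m : nat) :
  (forall D, D `<=` cross_polytope (n := n) -> separated r D -> D #<= `I_m) ->
  exists2 k : nat, is_gamma (@cross_polytope R n) r k & (k <= m)%N.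
Proof.
move=> ub.
pose P k := `[< exists D : set 'rV[R]_n,
  [/\ D `<=` cross_polytope (n := n), separated r D & D #= `I_k] >].
have P0 : exists k, P k.
  exists 0%N; apply/asboolP; exists set0; split=> [x|x y|] //.
  by rewrite II0; exact: card_eq00.
have Pm k : P k -> (k <= m)%N.
  by move=> /asboolP[D [DC sepD Dk]]; rewrite -card_le_II -(card_le_eql Dk) ub.
case: (ex_maxnP P0 Pm) => k Pk kmax; exists k; last exact: Pm.
split; first exact/asboolP.
move=> D DC sepD.
have /finite_setP[j Dj] : finite_set D.
  exact: card_le_finite (ub D DC sepD) (finite_II m).
by rewrite (card_le_eql Dj) card_le_II; apply: kmax; apply/asboolP; exists D.
Qed.

End Packing.

Section Dimension3.
Variable R : realType.
Implicit Types (x y : 'rV[R]_3) (r : R) (D : set 'rV[R]_3).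

Let i0 : 'I_3 := @Ordinal 3 0 isT.
Let i1 : 'I_3 := @Ordinal 3 1 isT.
Let i2 : 'I_3 := @Ordinal 3 2 isT.

Lemma sum3 (V : nmodType) (F : 'I_3 -> V) : \sum_(i < 3) F i = F i0 + F i1 + F i2.
Proof.
rewrite !big_ord_recl big_ord0 addr0 addrA.
by congr (F _ + F _ + F _); apply: val_inj.
Qed.

Lemma l1norm3 x : l1norm x = `|x ord0 i0| + `|x ord0 i1| + `|x ord0 i2|.
Proof. exact: sum3. Qed.

(** Adding two of these inequalities bounds an absolute value below by [d - 1], so later linear
    goals may treat the absolute values as arbitrary reals. *)
Lemma core3 d x : (forall i, ~~ in_cap d x i) ->
  [/\ `|x ord0 i0| + (d - 1) < `|x ord0 i1| + `|x ord0 i2|,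
      `|x ord0 i1| + (d - 1) < `|x ord0 i0| + `|x ord0 i2| &
      `|x ord0 i2| + (d - 1) < `|x ord0 i0| + `|x ord0 i1| ].
Proof.
rewrite /in_cap l1norm3 => h; move: (h i0) (h i1) (h i2); rewrite -!ltNge.
by split; lra.
Qed.

Definition octant x := (x ord0 i0 < 0, x ord0 i1 < 0, x ord0 i2 < 0).

Lemma octahedron_card_le14 r D :
  1 / 2 < r -> D `<=` cross_polytope (n := 3) -> separated r D ->
  D #<= `I_14.
Proof.
move=> r2 DC sepD.
have -> : 14%N = (3 * 2 + #|{: bool * bool * bool}|)%N.
  by rewrite !card_prod !card_bool.
apply: (@separated_card_le _ _ _ octant 1 r) => //; first lra.
move=> x y /core3[x0 x1 x2] /core3[y0 y1 y2] /[!l1norm3] xC yC [s0 s1 s2].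
rewrite !mxE (normB_same_sign s0) (normB_same_sign s1) (normB_same_sign s2).
move: x0 x1 x2 y0 y1 y2 xC yC.
move: `|x _ i0| `|x _ i1| `|x _ i2| `|y _ i0| `|y _ i1| `|y _ i2|.
move=> {s0 s1 s2 DC sepD} a b c a' b' c' x0 x1 x2 y0 y1 y2 xC yC.
by case: (lerP a' a); case: (lerP b' b); case: (lerP c' c); lra.
Qed.

Lemma octahedron_card_le10 r D :
  3 / 5 < r -> D `<=` cross_polytope (n := 3) -> separated r D ->
  D #<= `I_10.
Proof.
move=> r2 DC sepD.
have -> : 10%N = (3 * 2 + #|{: bool * bool}|)%N.
  by rewrite !card_prod !card_bool.
apply: (@separated_card_le _ _ _ (fun x => (octant x).1) (6 / 5) r) => //; first lra.
move=> x y /core3[x0 x1 x2] /core3[y0 y1 y2] /[!l1norm3] xC yC [s0 s1].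
rewrite !mxE (normB_same_sign s0) (normB_same_sign s1).
(* The third coordinates may differ in sign. *)
apply: le_trans (lerD (lexx _) (ler_normB _ _)) _.
move: x0 x1 x2 y0 y1 y2 xC yC.
move: `|x _ i0| `|x _ i1| `|x _ i2| `|y _ i0| `|y _ i1| `|y _ i2|.
move=> {s0 s1 DC sepD} a b c a' b' c' x0 x1 x2 y0 y1 y2 xC yC.
by case: (lerP a' a); case: (lerP b' b); lra.
Qed.

(* In units of 1/7 the tetrahedra are spanned by (1,1,1), (3,3,1), (3,1,3) and
   (1,3,3), up to signs.  The points (1,3,3) and (3,1,-3) are at distance 10 > 8,
   so from the tetrahedra with x_3 >= 0 one removes the copies scaled by 1/2
   at (3,1,3) and (1,3,3). *)
Definition top x : bool :=
  (0 <= x ord0 i2) &&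
  (3 / 7 < `|x ord0 i2| + `| `|x ord0 i0| - `|x ord0 i1| |).

Lemma octahedron_card_le12 r D :
  4 / 7 < r -> D `<=` cross_polytope (n := 3) -> separated r D ->
  D #<= `I_12.
Proof.
move=> r2 DC sepD.
(* An [inr] class joins the corners cut off from the two upper tetrahedra with the same sign of
   $x_1$. *)
pose col x : bool * bool + bool :=
  if top x then inr (x ord0 i0 < 0) else inl (octant x).1.
have -> : 12%N = (3 * 2 + #|{: bool * bool + bool}|)%N.
  by rewrite card_sum !card_prod !card_bool.
apply: (@separated_card_le _ _ _ col (8 / 7) r) => //; first lra.
move=> x y /core3[x0 x1 x2] /core3[y0 y1 y2] /[!l1norm3] xC yC.
rewrite /col; case: ifP => xt; case: ifP => yt // -[].
  move=> s0; move: xt yt => /andP[sx tx] /andP[sy ty].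
  have s2 : (x ord0 i2 < 0) = (y ord0 i2 < 0) by rewrite !ltNge sx sy.
  rewrite !mxE (normB_same_sign s0) (normB_same_sign s2).
  apply: le_trans (lerD (lerD (lexx _) (ler_normB _ _)) (lexx _)) _.
  move: x0 x1 x2 y0 y1 y2 xC yC tx ty.
  move: `|x _ i0| `|x _ i1| `|x _ i2| `|y _ i0| `|y _ i1| `|y _ i2|.
  move=> {s0 s2 sx sy DC sepD} a b c a' b' c' x0 x1 x2 y0 y1 y2 xC yC.
  case: (lerP b a) => ?; case: (lerP b' a') => ? tx ty;
  by case: (lerP a' a) => ?; case: (lerP c' c) => ?; lra.
move=> s0 s1; rewrite !mxE (normB_same_sign s0) (normB_same_sign s1).
have [s2|s2] := eqVneq (x ord0 i2 < 0) (y ord0 i2 < 0).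
  rewrite (normB_same_sign s2).
  move: x0 x1 x2 y0 y1 y2 xC yC.
  move: `|x _ i0| `|x _ i1| `|x _ i2| `|y _ i0| `|y _ i1| `|y _ i2|.
  move=> {s0 s1 s2 xt yt DC sepD} a b c a' b' c' x0 x1 x2 y0 y1 y2 xC yC.
  by case: (lerP a' a); case: (lerP b' b); case: (lerP c' c); lra.
apply: le_trans (lerD (lexx _) (ler_normB _ _)) _.
(* The point with nonnegative third coordinate is outside [top]. *)
have t : (`|x ord0 i2| + `| `|x ord0 i0| - `|x ord0 i1| | <= 3 / 7) ||
         (`|y ord0 i2| + `| `|y ord0 i0| - `|y ord0 i1| | <= 3 / 7).
  move: xt yt s2; rewrite /top !ltNge.
  by case: (0 <= x _ i2); case: (0 <= y _ i2); do 2 case: (_ <= 3 / 7).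
move: x0 x1 x2 y0 y1 y2 xC yC t.
move: `|x _ i0| `|x _ i1| `|x _ i2| `|y _ i0| `|y _ i1| `|y _ i2|.
move=> {s0 s1 s2 xt yt DC sepD} a b c a' b' c' x0 x1 x2 y0 y1 y2 xC yC.
by case: (lerP b a) => ?; case: (lerP b' a') => ? /orP[] t;
  case: (lerP a' a) => ?; case: (lerP b' b) => ?; lra.
Qed.

(** Missing entries read as 0, so [[::]] is the origin. *)
Definition l1dist_seq (p q : seq int) : int :=
  `|p`_0 - q`_0| + `|p`_1 - q`_1| + `|p`_2 - q`_2|.

(** Scaling by [1 / k] reduces a packing to integer checks done by computation. *)
Lemma integer_config_separated r (k m : nat) (ps : seq (seq int)) :
  (0 < k)%N -> 2 * r <= m%:R / k%:R ->
  all (fun p => l1dist_seq p [::] <= k) ps ->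
  pairwise (fun p q => m%:Z <= l1dist_seq p q) ps -> (0 < m)%N ->
  exists D, [/\ D `<=` cross_polytope (n := 3), separated r D & D #= `I_(size ps)].
Proof.
move=> k0 rm psC psm m0.
have kR : 0 < k%:R :> R by rewrite ltr0n.
pose v (p : seq int) : 'rV[R]_3 := \row_j ((p`_j)%:~R / k%:R).
have distE p q : l1norm (v p - v q) = (l1dist_seq p q)%:~R / k%:R.
  rewrite l1norm3 !mxE -!mulrBl !normrM (gtr0_norm (x := k%:R^-1)) ?invr_gt0 //.
  by rewrite -!mulrDl -!rmorphB -!intr_norm -!rmorphD.
have v0 : v [::] = 0 by apply/rowP => j; rewrite !mxE nth_nil mul0r.
have sep i j : (i < size ps)%N -> (j < size ps)%N -> i <> j ->
    m%:R / k%:R <= l1norm (v (nth [::] ps i) - v (nth [::] ps j)).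
  have dC p q : l1dist_seq p q = l1dist_seq q p.
    by rewrite /l1dist_seq !(distrC p`_ _).
  move=> ips jps /eqP; rewrite neq_ltn distE ler_pM2r ?invr_gt0 // pmulrn ler_int.
  move/(pairwiseP [::]): psm => psm.
  by move=> /orP[] ij; [|rewrite dC]; exact: psm.
have inj : {in `I_(size ps) &, injective (fun i => v (nth [::] ps i))}.
  move=> i j /[!inE] /= ips jps eqv; apply: contrapT => /(sep _ _ ips jps).
  rewrite eqv subrr l1norm3 !mxE normr0 !addr0 leNgt => /negP; apply.
  by rewrite divr_gt0 // ltr0n.
exists ((fun i => v (nth [::] ps i)) @` `I_(size ps)); split.
- move=> _ [i /= ips <-]; rewrite /cross_polytope /= -[v _]subr0 -v0 distE.
  rewrite ler_pdivrMr // mul1r pmulrn ler_int.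
  by move/allP: psC; apply; exact: mem_nth.
- move=> _ _ [i /= ips <-] [j /= jps <-] vij; apply: (le_trans rm).
  by apply: sep => // ij; apply: vij; rewrite ij.
- exact: inj_card_eq.
Qed.

(** In units of 1/3: the vertices and the centres of four facets, no two sharing an edge; the least
    distance is 4. *)
Definition config10 : seq (seq int) :=
  [:: [:: 3; 0; 0]; [:: -3; 0; 0]; [:: 0; 3; 0]; [:: 0; -3; 0]; [:: 0; 0; 3];
      [:: 0; 0; -3]; [:: 1; 1; 1]; [:: 1; -1; -1]; [:: -1; 1; -1]; [:: -1; -1; 1]].

(** In units of 1/5: the vertices and three antipodal pairs, one point in each facet but the
    all-positive and all-negative ones; the least distance is 6. *)
Definition config12 : seq (seq int) :=
  [:: [:: 5; 0; 0]; [:: -5; 0; 0]; [:: 0; 5; 0]; [:: 0; -5; 0]; [:: 0; 0; 5];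
      [:: 0; 0; -5]; [:: 1; -2; -2]; [:: 2; 2; -1]; [:: 2; -1; 2]; [:: -2; -2; 1];
      [:: -1; 2; 2]; [:: -2; 1; -2]].

End Dimension3.

Theorem theorem1p2 (R : realType) :
  [/\ forall r : R, 3 / 5 < r <= 2 / 3 ->
        is_gamma (@cross_polytope R 3) r 10,
      forall r : R, 4 / 7 < r <= 3 / 5 ->
        is_gamma (@cross_polytope R 3) r 12
    & forall r : R, 1 / 2 < r <= 4 / 7 ->
        exists2 m : nat, is_gamma (@cross_polytope R 3) r m & (m <= 14)%N ].
Proof.
split=> r /andP[rl ru].
- split=> [|D]; last exact: octahedron_card_le10.
  by apply: (@integer_config_separated _ r 3 4 config10) => //; lra.
- split=> [|D]; last exact: octahedron_card_le12.
  by apply: (@integer_config_separated _ r 5 6 config12) => //; lra.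
- by apply: is_gamma_ex_le => D; exact: octahedron_card_le14.
Qed.
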